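(* Let $I\subseteq\mathbb{R}$ be a finite interval of length $|I|$, let $N\ge1$, and let $\mu$ be a probability measure on $I^N$. Suppose there is some $\delta\ge0$ such that $$\operatorname{Cov}_\mu[f,g]\ge-\|f\|_\infty\|g\|_\infty\,\delta$$ for any coordinate-wise increasing $f,g:I^N\to\mathbb{R}$. Then for any functions $F,G:I^N\to\mathbb{R}$ (not necessarily increasing), $$\big|\operatorname{Cov}_\mu[F,G]\big|\le\sum_{i,j=1}^N\operatorname{Lip}_i(F)\operatorname{Lip}_j(G)\left(\operatorname{Cov}_\mu[X(i),X(j)]+4|I|^2\delta\right),$$ where $X\in I^N$ denotes a sample from $\mu$.
   Context: For $F:I^N\to\mathbb{R}$, $$\operatorname{Lip}_i(F)=\sup\left\{\frac{|F(x)-F(y)|}{|x(i)-y(i)|}:x,y\in I^N,\ x(i)\ne y(i),\ x(j)=y(j)\text{ for }j\ne i\right\}.$$ $\|f\|_\infty$ is the maximum possible absolute value that $f$ can take on $I^N$. Coordinate-wise increasing means nondecreasing in each coordinate. $\operatorname{Cov}_\mu[F,G]$ denotes $\operatorname{Cov}[F(X),G(X)]$ for $X\sim\mu$. *)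

(* Defs.v *)
From HB Require Import structures.
From mathcomp Require Import all_boot all_order all_algebra.
From mathcomp Require Import all_classical all_reals all_analysis.
Import Order.TTheory GRing.Theory Num.Theory.
Import numFieldNormedType.Exports.

Set Implicit Arguments.
Unset Strict Implicit.
Unset Printing Implicit Defensive.

Local Open Scope classical_set_scope.
Local Open Scope ring_scope.

(* The type does not depend on [I0]; it is a parameter because measurable types
   must be inhabited. *)
Definition itv_pt (R : realType) (I : interval R) (I0 : [set` I] !=set0) :
  Type := {x : R | x \in I}.

Section itv_pt_instances.
Context (R : realType) (I : interval R) (I0 : [set` I] !=set0).

HB.instance Definition _ := Choice.copy (itv_pt I0) {x : R | x \in I}.
HB.instance Definition _ := isPointed.Build (itv_pt I0)
  (exist _ (sval (cid I0)) (svalP (cid I0)) : {x : R | x \in I}).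

Definition itv_val (x : itv_pt I0) : measurableTypeR R := sval x.

(* The trace on I of the Borel sigma-algebra of R. *)
HB.instance Definition _ := @isMeasurable.Build (preimage_display itv_val)
  (itv_pt I0) (g_sigma_algebra_preimage itv_val)
  (@measurable0 _ (g_sigma_algebra_preimageType itv_val))
  (@measurableC _ (g_sigma_algebra_preimageType itv_val))
  (@bigcupT_measurable _ (g_sigma_algebra_preimageType itv_val)).

End itv_pt_instances.

(* I^N, whose library sigma-algebra is the product one. *)
Notation cube I0 N := (N.-tuple (itv_pt I0)).

Definition itv_length (R : realType) (I : interval R) : R :=
  sup [set` I] - inf [set` I].

Section cube_functions.
Context (R : realType) (I : interval R) (I0 : [set` I] !=set0) (N : nat).
Implicit Types (x y : cube I0 N) (F : cube I0 N -> R).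

Definition cube_coord (i : 'I_N) x : R := itv_val (tnth x i).

Definition coord_increasing F := forall (i : 'I_N) x y,
  (forall j, j != i -> cube_coord j x = cube_coord j y) ->
  cube_coord i x <= cube_coord i y -> F x <= F y.

(* Meaningful for bounded F: the real supremum of an unbounded set is 0. *)
Definition sup_norm F : R := sup [set `|F x| | x in [set: cube I0 N]].

(* Valued in [0, +oo]: the maximum with 0 only matters when I is a single
   point, where the set of quotients is empty. *)
Definition Lip (i : 'I_N) F : \bar R :=
  maxe 0%E (ereal_sup [set (`|F p.1 - F p.2| /
                            `|cube_coord i p.1 - cube_coord i p.2|)%:E | p in
    [set p : cube I0 N * cube I0 N | cube_coord i p.1 <> cube_coord i p.2 /\
       forall j, j != i -> cube_coord j p.1 = cube_coord j p.2]]).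

End cube_functions.

(* Main.v *)
(* With a = sum_i Lip_i(F) x(i) and b = sum_j Lip_j(G) x(j), all four of a + F,
   a - F, b + G, b - G are coordinate-wise increasing, and up to constants they
   are bounded by 2|I| sum_i Lip_i(F), resp. 2|I| sum_j Lip_j(G). The hypothesis
   thus bounds Cov[a + F, b + G] + Cov[a - F, b - G] = 2 Cov[a, b] + 2 Cov[F, G]
   from below, and replacing F by -F bounds Cov[a, b] - Cov[F, G].
   If some product Lip_i(F) Lip_j(G) is infinite, so is the right-hand side: its
   factors Cov[X(i), X(j)] + 4|I|^2 delta are nonnegative. If some Lip_i(F) is
   infinite but no product is, then G is constant, and symmetrically. *)
Require Import Defs.
From HB Require Import structures.
From mathcomp Require Import all_boot all_order all_algebra.
From mathcomp Require Import all_classical all_reals all_analysis.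
From mathcomp Require Import measurable_realfun ess_sup_inf lra.
Import Order.TTheory GRing.Theory Num.Theory.
Import numFieldNormedType.Exports.

Set Implicit Arguments.
Unset Strict Implicit.
Unset Printing Implicit Defensive.

Local Open Scope classical_set_scope.
Local Open Scope ring_scope.

(** The point [x0] and the bound [M] make the set nonempty and bounded, so [sup] is a genuine
    supremum and not a default value. *)
Lemma sup_normr_itv (T : Type) (R : realType) (x0 : T) (f : T -> R) (M : R) :
  (forall x, `|f x| <= M) -> 0 <= sup [set `|f x| | x in [set: T]] <= M.
Proof.
move=> fM; have fne : [set `|f x| | x in [set: T]] !=set0 by exists `|f x0|, x0.
apply/andP; split; last by apply: ge_sup => // _ [x _ <-].
apply: (le_trans (normr_ge0 (f x0))); apply: ub_le_sup; last by exists x0.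
by exists M => _ [x _ <-].
Qed.

(** * Bilinearity and finiteness of covariance on L^2 *)

Section bounded_covariance.
Local Open Scope ereal_scope.
Context d (T : measurableType d) (R : realType) (P : probability T R).

(** A probability space has finite measure, so L^oo is contained in L^2. *)
Lemma bounded_Lfun2 (f : T -> R) (M : R) :
  measurable_fun setT f -> (forall x, `|f x| <= M)%R -> f \in Lfun P 2%:E.
Proof.
move=> mf fM; have PT : P setT \is a fin_num by rewrite probability_setT.
apply: (@Lfun_subset _ _ _ P 2%:E +oo) => //; rewrite ?lee1n ?leey//.
rewrite inE; apply/andP; split; rewrite inE//= /finite_norm unlock /Lnorm.
case: ifP => [_|_]; last exact: ltry; apply: le_lt_trans (ltry M).
by apply/ess_supP/nearW => x /=; rewrite lee_fin.
Qed.

Lemma covariance_cstBl (c : R) (f g : T -> R) :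
  f \in Lfun P 2%:E -> g \in Lfun P 2%:E ->
  covariance P (f \- cst c)%R g = covariance P f g.
Proof.
by move=> f2 g2; rewrite covarianceBl ?Lfun_cst// covariance_cst_l sube0.
Qed.

Lemma covariance_fin_num2 (f g : T -> R) :
  f \in Lfun P 2%:E -> g \in Lfun P 2%:E -> covariance P f g \is a fin_num.
Proof.
move=> f2 g2; have PT : P setT \is a fin_num by rewrite probability_setT.
apply: covariance_fin_num; [exact: Lfun_subset12|exact: Lfun_subset12|].
exact: Lfun2_mul_Lfun1.
Qed.

Lemma covarianceN2l (f g : T -> R) :
  f \in Lfun P 2%:E -> g \in Lfun P 2%:E ->
  covariance P (\- f)%R g = - covariance P f g.
Proof.
move=> f2 g2; have PT : P setT \is a fin_num by rewrite probability_setT.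
apply: covarianceNl; [exact: Lfun_subset12|exact: Lfun_subset12|].
exact: Lfun2_mul_Lfun1.
Qed.

Lemma covarianceN2r (f g : T -> R) :
  f \in Lfun P 2%:E -> g \in Lfun P 2%:E ->
  covariance P f (\- g)%R = - covariance P f g.
Proof. by move=> f2 g2; rewrite covarianceC covarianceN2l// covarianceC. Qed.

(** Membership in L^2 is proved along with the formula because the induction step needs it for the
    tail of the sum. *)
Lemma covariance_suml (J : Type) (s : seq J) (a : J -> R) (h : J -> T -> R)
    (g : T -> R) :
  (forall j, h j \in Lfun P 2%:E) -> g \in Lfun P 2%:E ->
  ((fun x => \sum_(j <- s) a j * h j x)%R \in Lfun P 2%:E) /\
  covariance P (fun x => \sum_(j <- s) a j * h j x)%R g =
  \sum_(j <- s) (a j)%:E * covariance P (h j) g.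
Proof.
move=> h2 g2; have PT : P setT \is a fin_num by rewrite probability_setT.
elim: s => [|j s [IH1 IH2]].
  under eq_fun do rewrite big_nil.
  by rewrite big_nil -[fun _ => _]/(cst 0%R) Lfun_cst covariance_cst_l.
have -> : (fun x => \sum_(i <- j :: s) a i * h i x)%R =
    ((a j \o* h j) \+ (fun x => \sum_(i <- s) a i * h i x))%R.
  by apply/funext => x /=; rewrite big_cons mulrC.
have ah2 : (a j \o* h j)%R \in Lfun P 2%:E by rewrite Lfun_scale ?ler1n.
split; first by rewrite rpredD ?lee1n.
rewrite big_cons covarianceDl// IH2; congr (_ + _).
apply: covarianceZl; [exact: Lfun_subset12 PT _ (h2 j)|exact: Lfun_subset12|].
exact: Lfun2_mul_Lfun1.
Qed.

Lemma covariance_sum (J : finType) (a b : J -> R) (h : J -> T -> R) :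
  (forall j, h j \in Lfun P 2%:E) ->
  covariance P (fun x => \sum_j a j * h j x)%R (fun x => \sum_j b j * h j x)%R =
  \sum_i \sum_j (a i * b j)%:E * covariance P (h i) (h j).
Proof.
move=> h2; have sum2 c : (fun x => \sum_j c j * h j x)%R \in Lfun P 2%:E.
  by case: (covariance_suml (index_enum J) c h2 (Lfun_cst P 0%R 2%R)).
rewrite (covariance_suml _ _ h2 (sum2 b)).2; apply: eq_bigr => i _.
rewrite covarianceC (covariance_suml _ _ h2 (h2 i)).2 fin_num_sume_distrr//.
  by apply: eq_bigr => j _; rewrite covarianceC muleA EFinM.
(* Distributivity over an extended-real sum requires that no two terms be opposite infinities; here
   all are finite. *)
move=> j k _ _; rewrite fin_num_adde_defr// fin_numM// covariance_fin_num2//.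
Qed.

End bounded_covariance.

(** * Coordinate-wise Lipschitz functions on the cube *)

Section cube_geometry.
Context (R : realType) (I : interval R) (I0 : [set` I] !=set0) (N : nat).
Implicit Types (x y : cube I0 N) (F G : cube I0 N -> R) (L : 'I_N -> R).

Definition agree_off (i : 'I_N) x y :=
  forall j, j != i -> cube_coord j x = cube_coord j y.

(** Multiplied-out form of a bound on the quotients in [Lip], with real constants and no
    denominators. *)
Definition coord_lipschitz L F := forall i x y, agree_off i x y ->
  `|F x - F y| <= L i * `|cube_coord i x - cube_coord i y|.

(** The increasing function whose addition makes a Lipschitz function monotone. *)
Definition cube_linear L x : R := \sum_i L i * cube_coord i x.

Lemma cube_coord_inj x y : (forall i, cube_coord i x = cube_coord i y) -> x = y.
Proof. by move=> xy; apply: eq_from_tnth => i; apply: val_inj; exact: xy. Qed.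

Lemma cube_coord_itv i x : cube_coord i x \in I.
Proof. exact: (svalP (tnth x i)). Qed.

Lemma measurable_cube_coord i : measurable_fun setT (@cube_coord R I I0 N i).
Proof.
apply: (@measurableT_comp _ _ _ _ _ _ (@itv_val R I I0) _ (fun x => tnth x i)).
  (* [itv_val] is measurable because its preimages generate the sigma-algebra. *)
  by move=> _ B mB; rewrite setTI; exists B => //; rewrite setTI.
exact: measurable_tnth.
Qed.

Lemma cube_coord_dist (Ibounded : bounded_set [set` I]) i x y :
  `|cube_coord i x - cube_coord i y| <= itv_length I.
Proof.
have [M [_ IM]] := Ibounded.
have {}IM z : z \in I -> `|z| <= M + 1 by move=> zI; apply: IM; rewrite ?ltrDl.
have ubI : has_ubound [set` I].
  by exists (M + 1) => z zI; exact: le_trans (ler_norm z) (IM z zI).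
have lbI : has_lbound [set` I].
  by exists (- (M + 1)) => z /IM; rewrite ler_norml => /andP[].
have subI z w : z \in I -> w \in I -> z - w <= itv_length I.
  by move=> zI wI; rewrite lerB ?ub_le_sup ?ge_inf.
by rewrite ler_norml lerNl opprB !subI ?cube_coord_itv.
Qed.

(* Telescoping along the path from [y] to [x] that changes one coordinate at a
   time. *)
Lemma coord_lipschitz_dist L F x y : coord_lipschitz L F ->
  `|F x - F y| <= \sum_i L i * `|cube_coord i x - cube_coord i y|.
Proof.
move=> FL; pose z k : cube I0 N :=
  [tuple if (i < k)%N then tnth x i else tnth y i | i < N].
have zE k i : cube_coord i (z k) =
    if (i < k)%N then cube_coord i x else cube_coord i y.
  by rewrite /cube_coord tnth_mktuple; case: ifP.
have z0 : z 0 = y by apply: cube_coord_inj => i; rewrite zE.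
have zN : z N = x by apply: cube_coord_inj => i; rewrite zE ltn_ord.
have -> : F x - F y = \sum_(i < N) (F (z i.+1) - F (z i)).
  rewrite -zN -z0.
  by rewrite -(big_mkord xpredT (fun k => F (z k.+1) - F (z k))) telescope_sumr.
apply: (le_trans (ler_norm_sum _ _ _)); apply: ler_sum => i _.
have := FL i (z i.+1) (z i); rewrite !zE ltnSn ltnn; apply => j ji.
by rewrite !zE ltnS leq_eqVlt -val_eqE/= in ji *; rewrite (negbTE ji).
Qed.

Lemma coord_lipschitz_osc (Ibounded : bounded_set [set` I]) L F x y :
  (forall i, 0 <= L i) -> coord_lipschitz L F ->
  `|F x - F y| <= itv_length I * \sum_i L i.
Proof.
move=> L0 FL; apply: (le_trans (coord_lipschitz_dist x y FL)).
rewrite mulr_sumr; apply: ler_sum => i _.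
by rewrite mulrC ler_wpM2r// cube_coord_dist.
Qed.

Lemma cube_linear_agree_off L i x y : agree_off i x y ->
  cube_linear L x - cube_linear L y = L i * (cube_coord i x - cube_coord i y).
Proof.
move=> xy; rewrite /cube_linear -sumrB (bigD1 i)//= big1 ?addr0 ?mulrBr// => j ji.
by rewrite xy// subrr.
Qed.

Lemma cube_linear_lipschitz L :
  (forall i, 0 <= L i) -> coord_lipschitz L (cube_linear L).
Proof.
by move=> L0 i x y xy; rewrite (cube_linear_agree_off L xy) normrM ger0_norm.
Qed.

(** Raising coordinate [i] by t raises the linear part by [L i] t, and [F] can drop by at most that
    much. *)
Lemma cube_linearD_increasing L F : coord_lipschitz L F ->
  coord_increasing (cube_linear L \+ F).
Proof.
move=> FL i x y xy le_xy /=; have := cube_linear_agree_off L xy.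
have := FL i x y xy; rewrite (ler0_norm (eqbRL (subr_le0 _ _) le_xy)) ler_norml.
move=> /andP[_]; lra.
Qed.

(** Rational points cannot serve directly, as I may be a single irrational point. Instead a code
    lists, for each coordinate, a rational q and a precision n, and [near] picks a point of I within
    1/(n+1) of q when there is one. *)
Lemma cube_separable : exists D : nat -> cube I0 N, forall x (e : R), 0 < e ->
  exists k, forall i, `|cube_coord i x - cube_coord i (D k)| < e.
Proof.
pose near (qn : rat * nat) : itv_pt I0 :=
  xget point [set y | `|ratr qn.1 - itv_val y| < qn.2.+1%:R^-1].
pose D k : cube I0 N :=
  if unpickle k is Some t then [tuple near (tnth t i) | i < N] else point.
exists D => x e e0.
have [n ne] : exists n : nat, n.+1%:R^-1 < e / 2.
  have [n] := @ltr_add_invr R 0 (e / 2) (divr_gt0 e0 (ltr0n _ 2)).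
  by rewrite add0r => ne; exists n.
have n0 : 0 < n.+1%:R^-1 :> R by rewrite invr_gt0.
have qP i : exists q : rat, `|ratr q - cube_coord i x| < n.+1%:R^-1.
  have /rat_in_itvoo[q] : cube_coord i x - n.+1%:R^-1 < cube_coord i x + n.+1%:R^-1.
    by rewrite ltrD2l gtrN.
  by rewrite in_itv/= -ltr_distlC distrC => ?; exists q.
pose t : N.-tuple (rat * nat) := [tuple (sval (cid (qP i)), n) | i < N].
exists (pickle t) => i.
rewrite /D pickleK /cube_coord !tnth_mktuple.
set q := sval _.
have qx : `|ratr q - itv_val (tnth x i)| < n.+1%:R^-1 := svalP (cid (qP i)).
(* [near] does not fall back on its default: coordinate [i] of [x] is a candidate. *)
have qn : `|ratr q - itv_val (near (q, n))| < n.+1%:R^-1.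
  exact: (xgetI point
    (qx : [set y | `|ratr q - itv_val y| < n.+1%:R^-1] (tnth x i))).
rewrite (le_lt_trans (ler_distD (ratr q) _ _))// [ltRHS]splitr.
by apply: ltrD; [rewrite distrC; exact: lt_trans ne|exact: lt_trans ne].
Qed.

(* McShane: [F x] is the infimum over a countable dense set of points [q] of
   the measurable functions [F q + dist q x]. *)
Lemma coord_lipschitz_measurable L F : (forall i, 0 <= L i) ->
  coord_lipschitz L F -> measurable_fun setT F.
Proof.
move=> L0 FL; have [D DP] := cube_separable.
pose h k x := F (D k) + \sum_i L i * `|cube_coord i x - cube_coord i (D k)|.
have mh k : measurable_fun setT (h k).
  apply: measurable_funD => //; apply: measurable_sum => i.
  apply: measurable_funM => //; apply: measurableT_comp => //.
  by apply: measurable_funB => //; exact: measurable_cube_coord.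
move=> _; apply: (measurability _ (RGenInftyO.measurableE R)) => //.
move=> _ [_ [c ->] <-]; rewrite setTI.
have -> : F @^-1` `]-oo, c[ = \bigcup_k (h k @^-1` `]-oo, c[).
  apply/seteqP; split => x /=; rewrite in_itv/= => Fxc; last first.
    case: Fxc => k _ /=; rewrite in_itv/=; apply: le_lt_trans.
    rewrite -lerBlDl; apply: le_trans (coord_lipschitz_dist _ _ FL).
    exact: ler_norm.
  (* If [D k] is u-close to [x], then [h k x] is at most F x + 2us. The choice of [u] makes this c -
     u; the summand 1 keeps the denominator positive when s = 0. *)
  set s := \sum_i L i; have S0 : 0 < 1 + 2 * s.
    by rewrite ltr_pwDl// mulr_ge0// sumr_ge0.
  pose u := (c - F x) / (1 + 2 * s).
  have u0 : 0 < u by rewrite divr_gt0// subr_gt0.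
  have uS : u * (1 + 2 * s) = c - F x by rewrite divfK// gt_eqF.
  have [k kP] := DP x u u0; exists k => //=; rewrite in_itv/= /h.
  have : \sum_i L i * `|cube_coord i x - cube_coord i (D k)| <= u * s.
    by rewrite mulr_sumr ler_sum// => i _; rewrite mulrC ler_wpM2r// ltW.
  have := coord_lipschitz_dist x (D k) FL; rewrite ler_norml => /andP[+ _].
  by clearbody u s; lra.
apply: bigcup_measurable => k _; rewrite -[X in measurable X]setTI.
by apply: mh => //; exact: measurable_itv.
Qed.

End cube_geometry.

(** * Covariance bounds for finite Lipschitz constants *)

Section lipschitz_covariance.
Context (R : realType) (I : interval R) (I0 : [set` I] !=set0) (N : nat).
Hypothesis Ibounded : bounded_set [set` I].
Variables (mu : probability (cube I0 N) R) (delta : R).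
Hypothesis delta0 : 0 <= delta.
Hypothesis mu_assoc : forall f g : cube I0 N -> R,
  measurable_fun setT f -> measurable_fun setT g ->
  bounded_fun f -> bounded_fun g ->
  coord_increasing f -> coord_increasing g ->
  ((- (sup_norm f * sup_norm g * delta))%:E <= covariance mu f g)%E.
Implicit Types (F G : cube I0 N -> R) (L K : 'I_N -> R).

Lemma osc_Lfun2 F (M : R) : measurable_fun setT F ->
  (forall x y, `|F x - F y| <= M) -> F \in Lfun mu 2%:E.
Proof.
move=> mF FM; apply: (@bounded_Lfun2 _ _ _ mu _ (M + `|F point|)) => // x.
by rewrite -lerBlDr (le_trans (lerB_dist _ _)).
Qed.

Lemma coord_lipschitz_Lfun2 L F : (forall i, 0 <= L i) ->
  coord_lipschitz L F -> F \in Lfun mu 2%:E.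
Proof.
move=> L0 FL; apply: osc_Lfun2; first exact: coord_lipschitz_measurable FL.
by move=> x y; exact: coord_lipschitz_osc FL.
Qed.

Lemma cube_coord_Lfun2 i : @cube_coord R I I0 N i \in Lfun mu 2%:E.
Proof.
apply: osc_Lfun2; first exact: measurable_cube_coord.
by move=> x y; exact: cube_coord_dist.
Qed.

(* Covariance is blind to constants, so [f] and [g] may be centred at a point
   before [mu_assoc] is applied. *)
Lemma covariance_increasing_ge f g (M M' : R) :
  measurable_fun setT f -> measurable_fun setT g ->
  coord_increasing f -> coord_increasing g ->
  (forall x y, `|f x - f y| <= M) -> (forall x y, `|g x - g y| <= M') ->
  ((- (M * M' * delta))%:E <= covariance mu f g)%E.
Proof.
move=> mf mg f_incr g_incr fM gM.
pose cf := (f \- cst (f point)); pose cg := (g \- cst (g point)).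
have bounded h (B : R) : (forall x, `|h x| <= B) -> bounded_fun (h : cube I0 N -> R).
  move=> hB; exists B; split; first exact: num_real.
  by move=> y By x _; exact: le_trans (hB x) (ltW By).
have cfM x : `|cf x| <= M by exact: fM.
have cgM x : `|cg x| <= M' by exact: gM.
have f2 := osc_Lfun2 mf fM; have g2 := osc_Lfun2 mg gM.
have mcf : measurable_fun setT cf by exact: measurable_funB.
have mcg : measurable_fun setT cg by exact: measurable_funB.
have cf2 : cf \in Lfun mu 2%:E by exact: bounded_Lfun2 mcf cfM.
have -> : covariance mu f g = covariance mu cf cg.
  by rewrite covarianceC -(covariance_cstBl (g point) g2 f2) covarianceC
    -(covariance_cstBl (f point) f2)// (bounded_Lfun2 _ mcg cgM).
have /andP[cf0 cfM'] := sup_normr_itv point cfM.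
have /andP[cg0 cgM'] := sup_normr_itv point cgM.
apply: le_trans (mu_assoc _ _ _ _ _ _).
- rewrite lee_fin lerN2 ler_wpM2r//.
  by apply: ler_pM; [exact: cf0|exact: cg0|exact: cfM'|exact: cgM'].
- exact: mcf.
- exact: mcg.
- exact: bounded cfM.
- exact: bounded cgM.
- by move=> i x y xy le_xy; rewrite lerD2r; exact: f_incr le_xy.
- by move=> i x y xy le_xy; rewrite lerD2r; exact: g_incr le_xy.
Qed.

(** Coordinates are increasing with oscillation at most |I|, so their covariance is at least -|I|^2
    delta. This fixes the sign of the factors in the final bound. *)
Lemma covariance_coord_ge0 (i j : 'I_N) :
  (0 <= covariance mu (cube_coord i) (cube_coord j) +
        (4 * itv_length I ^+ 2 * delta)%:E)%E.
Proof.
have inc k : coord_increasing (@cube_coord R I I0 N k).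
  move=> l x y xy le_xy; have [->//|kl] := eqVneq k l; by rewrite xy.
have m k := @measurable_cube_coord R I I0 N k.
have d k := @cube_coord_dist R I I0 N Ibounded k.
have := covariance_increasing_ge (m i) (m j) (inc i) (inc j) (d i) (d j).
move/(leeD2r (4 * itv_length I ^+ 2 * delta)%:E); apply: le_trans.
rewrite -EFinD lee_fin.
by have := mulr_ge0 (sqr_ge0 (itv_length I)) delta0; rewrite expr2; lra.
Qed.

Lemma coord_lipschitzN L F : coord_lipschitz L F -> coord_lipschitz L (\- F).
Proof. by move=> FL i x y xy; rewrite -opprD normrN; exact: FL. Qed.

(* Both [cube_linear L + F] and [cube_linear L - F] are increasing. *)
Lemma covariance_linear_ge L K F G :
  (forall i, 0 <= L i) -> (forall i, 0 <= K i) ->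
  coord_lipschitz L F -> coord_lipschitz K G ->
  ((- (4 * itv_length I ^+ 2 * delta * ((\sum_i L i) * \sum_i K i)))%:E <=
   covariance mu (cube_linear L) (cube_linear K) + covariance mu F G)%E.
Proof.
move=> L0 K0.
(* Each of the two summands contributes |I|; the product of two such bounds yields the constant
   4. *)
have osc (C : 'I_N -> R) (H : cube I0 N -> R) : (forall i, 0 <= C i) ->
    coord_lipschitz C H -> forall x y,
    `|(cube_linear C \+ H) x - (cube_linear C \+ H) y| <=
    2 * itv_length I * \sum_i C i.
  move=> C0 HC x y; rewrite /= opprD addrACA.
  rewrite (le_trans (ler_normD _ _))// -mulrA mulr_natl mulr2n.
  apply: lerD; last exact: coord_lipschitz_osc C0 HC.
  exact: (coord_lipschitz_osc Ibounded x y C0 (cube_linear_lipschitz C0)).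
have main H H' : coord_lipschitz L H -> coord_lipschitz K H' ->
  ((- (4 * itv_length I ^+ 2 * delta * ((\sum_i L i) * \sum_i K i)))%:E <=
   covariance mu (cube_linear L \+ H) (cube_linear K \+ H'))%E.
  move=> HL HK; have mlin C C0 :=
    coord_lipschitz_measurable C0 (@cube_linear_lipschitz _ _ I0 _ C C0).
  apply: le_trans (covariance_increasing_ge _ _ _ _ (osc _ _ L0 HL) (osc _ _ K0 HK)).
  - by rewrite lee_fin; lra.
  - by apply: measurable_funD; [exact: mlin|exact: coord_lipschitz_measurable HL].
  - by apply: measurable_funD; [exact: mlin|exact: coord_lipschitz_measurable HK].
  - exact: cube_linearD_increasing.
  - exact: cube_linearD_increasing.
move=> FL GK; have FLN := coord_lipschitzN FL; have GKN := coord_lipschitzN GK.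
(* Adding the bounds for (F, G) and (-F, -G) cancels the mixed covariances and leaves twice the
   claim. *)
have := main _ _ FLN GKN; have := main _ _ FL GK.
have F2 := coord_lipschitz_Lfun2 L0 FL; have G2 := coord_lipschitz_Lfun2 K0 GK.
have F2N := coord_lipschitz_Lfun2 L0 FLN; have G2N := coord_lipschitz_Lfun2 K0 GKN.
have a2 := coord_lipschitz_Lfun2 L0 (@cube_linear_lipschitz _ _ I0 _ _ L0).
have b2 := coord_lipschitz_Lfun2 K0 (@cube_linear_lipschitz _ _ I0 _ _ K0).
rewrite !covarianceDl ?rpredD ?lee1n// !covarianceDr//.
rewrite !covarianceN2l// !covarianceN2r//.
rewrite -(fineK (covariance_fin_num2 a2 b2)) -(fineK (covariance_fin_num2 F2 b2)).
rewrite -(fineK (covariance_fin_num2 a2 G2)) -(fineK (covariance_fin_num2 F2 G2)).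
rewrite -!EFinN -!EFinD !lee_fin; lra.
Qed.

(** Bilinearity turns the double sum into the covariance of the linear parts plus a constant;
    [covariance_linear_ge] for (F, G) and (-F, G) then bounds both signs. *)
Lemma covariance_lipschitz_le L K F G :
  (forall i, 0 <= L i) -> (forall i, 0 <= K i) ->
  coord_lipschitz L F -> coord_lipschitz K G ->
  (`|covariance mu F G| <= \sum_i \sum_j (L i * K j)%:E *
    (covariance mu (cube_coord i) (cube_coord j) +
     (4 * itv_length I ^+ 2 * delta)%:E))%E.
Proof.
move=> L0 K0 FL GK; set c := 4 * _ * _.
have F2 := coord_lipschitz_Lfun2 L0 FL; have G2 := coord_lipschitz_Lfun2 K0 GK.
have a2 := coord_lipschitz_Lfun2 L0 (@cube_linear_lipschitz _ _ I0 _ _ L0).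
have b2 := coord_lipschitz_Lfun2 K0 (@cube_linear_lipschitz _ _ I0 _ _ K0).
have -> : (\sum_i \sum_j (L i * K j)%:E *
    (covariance mu (cube_coord i) (cube_coord j) + c%:E) =
    covariance mu (cube_linear L) (cube_linear K) +
    (c * ((\sum_i L i) * \sum_i K i))%:E)%E.
  rewrite (covariance_sum _ _ cube_coord_Lfun2) mulr_suml mulr_sumr -sumEFin -big_split/=.
  apply: eq_bigr => i _; rewrite mulr_sumr mulr_sumr -sumEFin -big_split/=.
  apply: eq_bigr => j _; rewrite muleDr ?fin_num_adde_defl//.
  by rewrite [c * _]mulrC EFinM.
have := covariance_linear_ge L0 K0 (coord_lipschitzN FL) GK.
have := covariance_linear_ge L0 K0 FL GK.
rewrite covarianceN2l// -/c.
rewrite -(fineK (covariance_fin_num2 a2 b2)) -(fineK (covariance_fin_num2 F2 G2)).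
rewrite -EFinN -!EFinD abse_EFin !lee_fin ler_norml => ? ?; apply/andP; lra.
Qed.

End lipschitz_covariance.

(** * From extended-real to real Lipschitz constants *)

Section lipschitz_constant.
Context (R : realType) (I : interval R) (I0 : [set` I] !=set0) (N : nat).
Implicit Types (x y : cube I0 N) (F G : cube I0 N -> R).

Lemma Lip_ge0 i F : (0 <= Lip i F)%E.
Proof. by rewrite /Lip le_max lexx. Qed.

(** The supremum controls pairs that differ at [i]; pairs that agree there as well coincide. *)
Lemma Lip_coord_lipschitz F : (forall i, Lip i F \is a fin_num) ->
  coord_lipschitz (fun i => fine (Lip i F)) F.
Proof.
move=> Ffin i x y xy; have [xyi|xyi] := eqVneq (cube_coord i x) (cube_coord i y).
  suff -> : x = y by rewrite !subrr normr0 mulr0.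
  by apply: cube_coord_inj => j; have [->|/xy] := eqVneq j i.
rewrite -ler_pdivrMr ?normr_gt0 ?subr_eq0// -lee_fin fineK//.
rewrite le_max; apply/orP; right; apply: ereal_sup_ubound.
by exists (x, y) => //; split => //; exact/eqP.
Qed.

(** Telescoping shows that [F] is constant. [G] is arbitrary, so it may have infinite Lipschitz
    constants. *)
Lemma Lip_eq0_covariance (mu : probability (cube I0 N) R) F G :
  (forall i, Lip i F = 0%E) -> covariance mu F G = 0%E.
Proof.
move=> F0; have FL := @Lip_coord_lipschitz F.
have -> : F = cst (F point); last exact: covariance_cst_l.
apply/funext => x; apply/eqP; rewrite -subr_eq0 -normr_le0.
apply: le_trans (coord_lipschitz_dist _ _ (FL _)) _ => [i|]; first by rewrite F0.
by rewrite big1// => i _; rewrite F0 mul0r.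
Qed.

End lipschitz_constant.

(** * The general bound, with infinite constants allowed *)

Local Open Scope ereal_scope.

Theorem theorem5p1 (R : realType) (I : interval R) (I0 : [set` I] !=set0)
  (Ibounded : bounded_set [set` I]) (N : nat) (N1 : (1 <= N)%N)
  (mu : probability (cube I0 N) R) (delta : R) (delta0 : (0 <= delta)%R)
  (Hmu : forall f g : cube I0 N -> R,
    measurable_fun setT f -> measurable_fun setT g ->
    bounded_fun f -> bounded_fun g ->
    coord_increasing f -> coord_increasing g ->
    (- (sup_norm f * sup_norm g * delta))%:E <= covariance mu f g)
  (F G : cube I0 N -> R)
  (* No term of the bound below is an indeterminate product +oo * 0. *)
  (FGdef : forall i j : 'I_N, mule_def (Lip i F * Lip j G)
    (covariance mu (cube_coord i) (cube_coord j) + (4 * itv_length I ^+ 2 * delta)%:E)) :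
  `|covariance mu F G| <=
  \sum_(i < N) \sum_(j < N) Lip i F * Lip j G *
    (covariance mu (cube_coord i) (cube_coord j) + (4 * itv_length I ^+ 2 * delta)%:E).
Proof.
set c := (4 * itv_length I ^+ 2 * delta)%:E.
have cov0 (i j : 'I_N) : 0 <= covariance mu (cube_coord i) (cube_coord j) + c.
  exact: covariance_coord_ge0.
have term0 k l : 0 <= Lip k F * Lip l G *
    (covariance mu (cube_coord k) (cube_coord l) + c).
  by apply: mule_ge0; [apply: mule_ge0; exact: Lip_ge0|exact: cov0].
have [[i [j FGij]]|FGfin] := pselect (exists i j, Lip i F * Lip j G = +oo).
  suff -> : \sum_(i < N) \sum_(j < N) Lip i F * Lip j G *
      (covariance mu (cube_coord i) (cube_coord j) + c) = +oo by rewrite leey.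
  have termy : Lip i F * Lip j G *
      (covariance mu (cube_coord i) (cube_coord j) + c) = +oo.
    (* [FGdef] excludes +oo * 0, so the nonnegative covariance factor is positive. *)
    rewrite FGij gt0_mulye// lt0e cov0 andbT.
    by apply: contraPneq (FGdef i j) => E; rewrite FGij -/c E mule_defE !eqxx.
  apply/eqP; rewrite -leye_eq -termy (bigD1 i)//= (bigD1 j)//= -addeA leeDl//.
  by rewrite adde_ge0// sume_ge0// => k _; rewrite sume_ge0.
(* This settles the cases where [F] or [G] is constant and the covariance is 0. *)
have rhs0 : 0 <= \sum_(i < N) \sum_(j < N) Lip i F * Lip j G *
    (covariance mu (cube_coord i) (cube_coord j) + c).
  by rewrite sume_ge0// => i _; rewrite sume_ge0// => j _; exact: term0.
(* An infinite [Lip i H] forces every [Lip j H'] to vanish, since a positive one would give an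
   infinite product. Both orders of [F] and [G] are used. *)
have Lipfin (H H' : cube I0 N -> R) :
    (forall i j, Lip i H * Lip j H' <> +oo) ->
    (forall i, Lip i H \is a fin_num) \/ (forall j, Lip j H' = 0).
  move=> HH'; have [?|/existsNP[i /negP Hi]] :=
    pselect (forall i, Lip i H \is a fin_num); [by left|right => j].
  apply: contra_notP (HH' i j) => /eqP H'j.
  have -> : Lip i H = +oo.
    by apply/eqP; move: Hi; rewrite ge0_fin_numE ?Lip_ge0// -leNgt leye_eq.
  by rewrite gt0_mulye// lt0e H'j Lip_ge0.
case: (Lipfin F G) => [i j FGij|Ffin|G0]; first by apply: FGfin; exists i, j.
  case: (Lipfin G F) => [i j FGij|Gfin|F0].
  - by apply: FGfin; exists j, i; rewrite muleC.
  - have fin0 (H : cube I0 N -> R) i : (0 <= fine (Lip i H))%R.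
      by rewrite fine_ge0// Lip_ge0.
    have := covariance_lipschitz_le Ibounded delta0 Hmu (fin0 F) (fin0 G)
      (Lip_coord_lipschitz Ffin) (Lip_coord_lipschitz Gfin).
    move=> /le_trans; apply; rewrite le_eqVlt; apply/orP; left; apply/eqP.
    by apply: eq_bigr => i _; apply: eq_bigr => j _; rewrite EFinM !fineK.
  - by rewrite Lip_eq0_covariance// abse0.
by rewrite covarianceC Lip_eq0_covariance// abse0.
Qed.
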